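(* Let $N\in\mathbb{N}$, $N\ge 1$, let $(M,d,m)$ be a Polish metric measure space, let $h>0$, and let $(M_h,d,m_h)$ be a discretization of $(M,d,m)$ at scale $h$. If $(M,d,m)$ satisfies $BM(N)$, then $(M_h,d,m_h)$ satisfies $BM(N,4h)$.
   Context: Polish metric measure space: a triple $(M,d,m)$ where $(M,d)$ is a Polish metric space and $m$ is a Borel measure on $(M,d)$ with full support, i.e. $m$ charges every ball of $M$. Discretization: let $h>0$ and let $M_h=\{x_i : i\ge1\}$ be a countable subset of $M$ with $M=\bigcup_{i\ge1}B_h(x_i)$, where $B_h(x)$ is the ball of radius $h$ centered at $x$. Choose mutually disjoint measurable sets $A_i\subset B_h(x_i)$ with $x_i\in A_i$ and $\bigcup_{i\ge1}A_i=M$. Let $m_h$ be the measure on $M_h$ given by $m_h(\{x_i\})=m(A_i)$ for $i\ge1$. Then $(M_h,d,m_h)$, with $d$ restricted to $M_h$, is called a discretization of $(M,d,m)$ (at scale $h$). Approximated Brunn-Minkowski inequality: let $(X,d)$ be a metric space with a Borel measure $\mu$, let $k\ge 0$ and $N\in\mathbb{N}$, $N\ge1$. For $C_0,C_1\subset X$ and $s\in[0,1]$, put $$C_s^k=\{x\in X : \exists (x_0,x_1)\in C_0\times C_1,\ |d(x_0,x)-s\,d(x_0,x_1)|\le k \text{ and } |d(x,x_1)-(1-s)\,d(x_0,x_1)|\le k\}.$$ The space $(X,d,\mu)$ satisfies $BM(N,k)$ if for all compact sets $C_0,C_1\subset X$ and all $s\in[0,1]$, $$\mu(C_s^k)^{1/N}\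 \ge\ (1-s)\,\mu(C_0)^{1/N}+s\,\mu(C_1)^{1/N}.$$ $BM(N)$ means $BM(N,0)$.
   Formalization: The Borel measure m is assumed sigma-finite (true of every locally finite one; for arbitrary Borel measures the claim fails), and the inequalities BM(N) and BM(N,4h) are required for nonempty compact sets C_0, C_1 only. *)

(* Defs.v *)
From HB Require Import structures.
From mathcomp Require Import all_boot all_order all_algebra.
From mathcomp Require Import all_classical all_reals all_analysis.

Set Implicit Arguments.
Unset Strict Implicit.
Unset Printing Implicit Defensive.

Import Order.TTheory GRing.Theory Num.Theory.

Local Open Scope classical_set_scope.
Local Open Scope ring_scope.

(* The library's measurable types are pointed, so a metric space carrying a
   measure is nonempty here. *)
#[short(type="pointedMetricType")]
HB.structure Definition PointedMetric (K : numDomainType) :=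
  {M of PseudoPointedMetric K M & PseudoMetric_isMetric K M}.

#[short(type="completeMetricType")]
HB.structure Definition CompleteMetric (K : numDomainType) :=
  {M of Complete M & PointedMetric K M}.

Definition borel (T : ptopologicalType) := g_sigma_algebraType (@open T).

Definition separable_space (T : topologicalType) : Prop :=
  exists2 S : set T, countable S & dense S.

Definition full_support (R : realType) (M : pointedMetricType R)
    (m : {measure set (borel M) -> \bar R}) : Prop :=
  forall (x : M) (r : R), 0 < r -> (0 < m (ball x r))%E.

(* "Borel measure" is read as sigma-finite Borel measure, which every locally
   finite one is, M being separable.  For arbitrary Borel measures the
   discretization theorem fails: on the Baire space, give meager sets mass 0 and
   all other sets mass +oo; compact sets are then null, so BM(N) holds, whereas
   for small h some nonmeager cells give atoms of infinite mass without any
   approximate midpoint. *)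
Definition polish_mmspace (R : realType) (M : completeMetricType R)
    (m : {measure set (borel M) -> \bar R}) : Prop :=
  [/\ separable_space M, sigma_finite [set: borel M] m & full_support m].

Definition interp (R : realType) (X : pointedMetricType R) (k s : R)
    (C0 C1 : set X) : set X :=
  [set x | exists x0 x1, [/\ C0 x0, C1 x1,
     `|mdist x0 x - s * mdist x0 x1| <= k &
     `|mdist x x1 - (1 - s) * mdist x0 x1| <= k]].

(* Nonemptiness is needed: if C0 is empty then so is [interp k s C0 C1], and
   the inequality would force every compact set to be negligible. *)
Definition BM (R : realType) (X : pointedMetricType R)
    (mu : {measure set (borel X) -> \bar R}) (N : nat) (k : R) : Prop :=
  forall C0 C1 : set X, compact C0 -> compact C1 -> C0 !=set0 -> C1 !=set0 ->
  forall s : R, 0 <= s <= 1 ->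
  ((1 - s)%:E * poweR (mu C0) N%:R^-1 + s%:E * poweR (mu C1) N%:R^-1
     <= poweR (mu (interp k s C0 C1)) N%:R^-1)%E.

(* The subset S, as a metric space of its own for the restricted distance. *)
Definition metric_sub (R : realType) (M : pointedMetricType R) (S : set M)
  (S0 : S !=set0) : Type := set_type S.

Section metric_sub.
Context (R : realType) (M : pointedMetricType R) (S : set M) (S0 : S !=set0).
Local Notation T := (metric_sub S0).

HB.instance Definition _ := PseudoMetric.copy T (set_type S).

HB.instance Definition _ := isPointed.Build T
  (SigSub (mem_set (svalP (cid S0))) : set_type S).

Definition metric_sub_val (x : T) : M := set_val (x : set_type S).

Let dist (x y : T) : R := mdist (metric_sub_val x) (metric_sub_val y).

Let dist_ge0 x y : 0 <= dist x y. Proof. exact: mdist_ge0. Qed.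

Let dist_positivity x y : dist x y = 0 -> x = y.
Proof. by move/mdist_positivity/val_inj. Qed.

Let ballEdist (x : T) (d : R) : ball x d = [set y | dist x y < d].
Proof.
rewrite -[LHS](@initial_ballE R (set_type S) M set_val d x).
by rewrite ballEmdist.
Qed.

HB.instance Definition _ :=
  PseudoMetric_isMetric.Build R T dist_ge0 dist_positivity ballEdist.

End metric_sub.

(* The sequence (x_i) is identified with the countable set Mh (finite or not)
   and the cells A_i are indexed by the points x_i themselves, which are
   pairwise distinct since x_i lies in A_i and the A_i are disjoint. *)
Definition discretization (R : realType) (M : pointedMetricType R)
    (m : {measure set (borel M) -> \bar R}) (h : R)
    (Mh : set M) (Mh0 : Mh !=set0)
    (mh : {measure set (borel (metric_sub Mh0)) -> \bar R}) : Prop :=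
  [/\ countable Mh,
      \bigcup_(x in Mh) ball x h = setT &
      exists A : M -> set M,
        [/\ forall x, Mh x -> measurable (A x : set (borel M)),
            forall x, Mh x -> A x `<=` ball x h,
            forall x, Mh x -> A x x,
            trivIset Mh A &
            \bigcup_(x in Mh) A x = setT /\
            forall x : metric_sub Mh0, mh [set x] = m (A (metric_sub_val x))]].

(* Main.v *)
Require Import Defs.
From HB Require Import structures.
From mathcomp Require Import all_boot all_order all_algebra.
From mathcomp Require Import all_classical all_reals all_analysis.
From mathcomp Require Import borel_hierarchy.
From mathcomp Require Import ring lra.

Import Order.TTheory GRing.Theory Num.Theory.
Local Open Scope classical_set_scope.
Local Open Scope ring_scope.

Set Implicit Arguments.
Unset Strict Implicit.
Unset Printing Implicit Defensive.

(** The proof transports compact sets of [Mh] to the union of their cells, and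
    back.  For C in [Mh], the union [cells A C] has [m]-mass [mh C]
    ([discretization_mass]), so one would like to apply BM(N) to the sets
    D0 = [cells A C0] and D1 = [cells A C1].  An intermediate point z of k0 in D0
    and k1 in D1 lies in the cell of some x in [Mh]; replacing k0, k1, z by the
    centres of their cells moves each of them by at most h, hence changes the two
    quantities that define intermediate points by at most 2h + s 2h <= 4h
    ([interp_point_perturb]).  So z belongs to the cells of the 4h-approximate
    intermediate set, whose mass is the one that the inequality bounds from below.

    The cells are merely Borel whereas BM(N) speaks of compact sets.  The gap is
    filled by inner regularity: a sigma-finite Borel measure on a Polish space is
    inner regular for compact sets ([sigma_finite_inner_regular]).  It reduces
    to finite measures, where Ulam's tightness theorem makes closed sets
    approximable by compact ones, and the sets that are approximable together
    with their complement form a sigma-algebra.  BM(N) holds for all compact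
    K0 in D0 and K1 in D1, and its left member is then taken to the supremum
    ([inner_regular_poweR], [lee_convex_of_lt]), masses being possibly infinite.
    Comparing masses needs the exact intermediate set of K0 and K1 to be
    Borel: it is closed ([closed_interp]). *)

(** * Approximation lemmas for measures *)

(** Continuity from above: the differences decrease to the empty set. *)
Lemma measure_setD_bigcup_small d (T : measurableType d) (R : realType)
    (mu : {measure set T -> \bar R}) (F : (set T)^nat) (e : R) :
  (forall n, measurable (F n)) -> (mu (\bigcup_n F n) < +oo)%E -> 0 < e ->
  exists N, (mu ((\bigcup_n F n) `\` \bigcup_(n < N) F n) <= e%:E)%E.
Proof.
move=> mF Ffin e0; set X := \bigcup_n F n.
have mX : measurable X by exact: bigcup_measurable.
pose G N := X `\` \bigcup_(n < N) F n.
have mG N : measurable (G N).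
  by apply: measurableD => //; exact: bigcup_measurable.
have G0 : \bigcap_n G n = set0.
  rewrite -subset0 => x Gx; have [[n _ Fnx] _] := Gx 0%N I.
  by have [_] := Gx n.+1 I; apply; exists n => /=.
have : mu \o G @ \oo --> mu (\bigcap_n G n).
  apply: nonincreasing_cvg_mu => //.
  - apply: le_lt_trans Ffin; apply: le_measure; rewrite ?inE//.
    exact: subDsetl.
  - exact: bigcap_measurable.
  - move=> i j ij; apply/subsetPset; apply: setDS => x [k /= ki Fx].
    by exists k => //=; exact: leq_trans ij.
rewrite G0 measure0 => /fine_cvgP[[N1 _ N1P]] /cvgrPdist_le/(_ _ e0)[N2 _ N2P].
exists (maxn N1 N2); have := N2P (maxn N1 N2) (leq_maxr _ _).
have /= fin := N1P (maxn N1 N2) (leq_maxl _ _).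
rewrite /= sub0r normrN => /(le_trans (ler_norm _)).
by rewrite -lee_fin fineK.
Qed.

(** Subadditivity with a geometric series of errors, the form in which the
    tightness theorem and the stability of compact approximation use it. *)
Lemma measure_le_geometric d (T : measurableType d) (R : realType)
    (mu : {measure set T -> \bar R}) (D : (set T)^nat) (X : set T) (e : R) :
  0 <= e -> (forall n, measurable (D n)) -> measurable X ->
  X `<=` \bigcup_n D n ->
  (forall n, (mu (D n) <= (e / (2 ^ n.+1)%:R)%:E)%E) ->
  (mu X <= e%:E)%E.
Proof.
move=> e0 mD mX XD De; apply: le_trans (epsilon_trick0 xpredT e0).
apply: le_trans (measure_sigma_subadditive _ mD mX XD) _.
by apply: lee_nneseries => // n _; exact: De.
Qed.

(** * Topology of complete separable metric spaces *)

(** The n-th closed set consists, roughly, of the points at distance at least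
    1/(n+1) from the complement of U; the interiors of the balls are removed
    because the balls of a pseudometric structure need not be open. *)
Lemma open_is_Fsigma (R : realType) (M : pseudoMetricType R) (U : set M) :
  open U -> Fsigma U.
Proof.
move=> oU.
exists (fun n => ~` \bigcup_(y in ~` U) (ball y n.+1%:R^-1)°).
  move=> n; apply: open_closedC; apply: bigcup_open => y _.
  exact: open_interior.
apply/seteqP; split => [x Ux|x [n _ nx]]; last first.
  apply: contrapT => Ux; apply: nx; exists x => //.
  by apply: nbhsx_ballx; rewrite invr_gt0.
have /nbhs_ballP[_/posnumP[e] xU] : nbhs x U by exact: open_nbhs_nbhs.
have [n _ /(_ n (leqnn n)) ne] := near_infty_natSinv_lt e.
exists n => // -[y Uy /interior_subset yx]; apply: Uy; apply: xU.
exact: (le_ball (ltW ne)) (ball_sym yx).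
Qed.

Lemma separable_dense_sequence (T : ptopologicalType) : separable_space T ->
  exists x : nat -> T, forall O, O !=set0 -> open O -> exists n, O (x n).
Proof.
move=> [S /pcard_surjP[x Sx] dS]; exists x => O O0 oO.
by have [y [Oy /Sx[n _ xn]]] := dS _ O0 oO; exists n; rewrite xn.
Qed.

Lemma ultrafilter_bigcup_fin (T : Type) (F : set_system T) (A : nat -> set T) N :
  UltraFilter F -> F (\bigcup_(n < N) A n) -> exists n, F (A n).
Proof.
move=> UF; elim: N => [|N IH].
  by rewrite II0 bigcup_set0 => F0; have [] := filter_not_empty F.
rewrite IIS bigcup_setU bigcup_set1 => FU.
have [|FN] := in_ultra_setVsetC (A N) UF; first by exists N.
by apply: IH; apply: filterS (filterI FU FN) => x [[//|]].
Qed.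

(** An ultrafilter on the intersection contains, at each scale r k, one of
    finitely many balls, so it is Cauchy; it converges by completeness. *)
Lemma closed_totally_bounded_compact (R : realType) (M : completeMetricType R)
    (x : nat -> M) (N : nat -> nat) (r : nat -> R) :
  (forall e, 0 < e -> exists k, r k < e) ->
  compact (\bigcap_k \bigcup_(n < N k) closure (ball (x n) (r k))).
Proof.
move=> r0; set K := \bigcap_k _.
have cK : closed K.
  apply: closed_bigI => k _; apply: closed_bigcup => // n _.
  exact: closed_closure.
rewrite compact_ultra => F UF FK.
have cF : cauchy F.
  apply: cauchy_exP => e e0.
  have e20 : 0 < e / 2 by rewrite divr_gt0.
  have [k rke] := r0 _ e20.
  have : F (\bigcup_(n < N k) closure (ball (x n) (r k))).
    by apply: filterS FK => y /(_ k I).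
  move=> /ultrafilter_bigcup_fin[n Fn]; exists (x n).
  apply: filterS Fn => y /(_ (ball y (e / 2))).
  move=> /(_ (nbhsx_ballx _ _ e20)) [z [xz yz]].
  rewrite [e]splitr; apply: ball_triangle (ball_sym yz).
  exact: le_ball (ltW rke) _ xz.
have Fp : F --> lim F by exact: cauchy_cvg.
exists (lim F); split => //; exact: (closed_cvg K cK) Fp.
Qed.

(** * Inner regularity *)

Lemma closed_borel (T : ptopologicalType) (A : set T) :
  closed A -> measurable (A : set (borel T)).
Proof.
move=> cA; rewrite -[A]setCK; apply: measurableC.
by apply: sub_sigma_algebra; exact: closed_openC.
Qed.

Lemma compact_borel (R : realType) (M : pointedMetricType R) (A : set M) :
  compact A -> measurable (A : set (borel M)).
Proof.
move=> cA; apply: closed_borel; apply: compact_closed cA.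
exact: metric_hausdorff.
Qed.

Section inner_regularity.
Context (R : realType) (M : completeMetricType R).
Hypothesis sepM : separable_space M.

Section finite_measure.
Variable mu : {measure set (borel M) -> \bar R}.
Hypothesis mufin : (mu setT < +oo)%E.

(** Ulam's theorem.  At scale 1/(k+1), finitely many closed balls centred at
    a dense sequence cover all but e/2^(k+1) of the mass; the intersection over
    k of these finite unions is totally bounded. *)
Lemma finite_measure_tight (e : R) : 0 < e ->
  exists2 K : set M, compact K & (mu (~` K) <= e%:E)%E.
Proof.
move=> e0; have [x dx] := @separable_dense_sequence M sepM.
pose r k : R := k.+1%:R^-1; have r_gt0 k : 0 < r k by rewrite invr_gt0.
pose B k n : set M := closure (ball (x n) (r k)).
have mB k n : measurable (B k n : set (borel M)).
  by apply: closed_borel; exact: closed_closure.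
have BT k : \bigcup_n B k n = [set: M].
  rewrite -subTset => y _.
  have y_int : (ball y (r k))° !=set0 by exists y; exact: nbhsx_ballx.
  have [n] := dx _ y_int (open_interior _).
  by move=> /interior_subset/ball_sym yx; exists n => //; exact: subset_closure.
have /choice[N BN] : forall k, exists N,
    (mu (~` \bigcup_(n < N) B k n) <= (e / (2 ^ k.+1)%:R)%:E)%E.
  move=> k.
  have ek0 : 0 < e / (2 ^ k.+1)%:R by rewrite divr_gt0// ltr0n expn_gt0.
  have Bfin : (mu (\bigcup_n B k n) < +oo)%E by rewrite BT.
  have [N BN] := measure_setD_bigcup_small (mB k) Bfin ek0.
  by exists N; rewrite -setTD -(BT k).
exists (\bigcap_k \bigcup_(n < N k) B k n).
  apply: closed_totally_bounded_compact => d d0.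
  have [n _ /(_ n (leqnn n)) nd] := near_infty_natSinv_lt (PosNum d0).
  by exists n.
have mC k : measurable (~` \bigcup_(n < N k) B k n : set (borel M)).
  by apply: measurableC; exact: bigcup_measurable.
apply: (measure_le_geometric (ltW e0) mC) => //; last by rewrite setC_bigcap.
by rewrite setC_bigcap; exact: bigcup_measurable.
Qed.

Definition compact_approx (A : set M) : Prop :=
  forall e : R, 0 < e ->
    exists K, [/\ compact K, K `<=` A & (mu (A `\` K) <= e%:E)%E].

Let measure_lt_pinfty (A : set (borel M)) : measurable A -> (mu A < +oo)%E.
Proof.
by move=> mA; apply: le_lt_trans mufin; apply: le_measure; rewrite ?inE.
Qed.

Let le_mu (A B : set (borel M)) : measurable A -> measurable B -> A `<=` B ->
  (mu A <= mu B)%E.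
Proof. by move=> mA mB; apply: le_measure; rewrite inE. Qed.

Lemma compact_approx_closed (A : set M) : closed A -> compact_approx A.
Proof.
move=> cA e e0; have [K cK Ke] := finite_measure_tight e0.
exists (K `&` A); split; [exact: compact_closedI|exact: subIsetr|].
have mA := closed_borel cA; have mK := compact_borel cK.
apply: le_trans Ke; apply: le_mu; [|exact: measurableC|].
  by apply: measurableD => //; exact: measurableI.
by move=> x [Ax nKA] Kx; apply: nKA.
Qed.

Let pow2_gt0 (e : R) n : 0 < e -> 0 < e / (2 ^ n.+1)%:R.
Proof. by move=> e0; rewrite divr_gt0// ltr0n expn_gt0. Qed.

(** Two errors of e/2: approximating each A n by a compact set, then keeping
    finitely many of these compact sets, since a countable union of compact sets
    need not be compact. *)
Lemma compact_approx_bigcup (A : (set M)^nat) :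
  (forall n, measurable (A n : set (borel M))) ->
  (forall n, compact_approx (A n)) -> compact_approx (\bigcup_n A n).
Proof.
move=> mA aA e e0; have e20 : 0 < e / 2 by rewrite divr_gt0.
have /choice[K KP] := fun n => aA n _ (pow2_gt0 n e20).
have mK n : measurable (K n : set (borel M)).
  by have [/compact_borel] := KP n.
have mUK : measurable (\bigcup_n K n : set (borel M)).
  exact: bigcup_measurable.
have mUA : measurable (\bigcup_n A n : set (borel M)).
  exact: bigcup_measurable.
have [N KN] :=
  @measure_setD_bigcup_small _ _ _ mu K _ mK (measure_lt_pinfty mUK) e20.
have mUN : measurable (\bigcup_(n < N) K n : set (borel M)).
  exact: bigcup_measurable.
exists (\bigcup_(n < N) K n); split.
- by rewrite bigcup_mkord; apply: bigsetU_compact => i _; have [] := KP i.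
- by move=> x [n _ Kx]; exists n => //; have [_ /(_ _ Kx)] := KP n.
have AK : (mu ((\bigcup_n A n) `\` \bigcup_n K n) <= (e / 2)%:E)%E.
  apply: (@measure_le_geometric _ _ _ mu (fun n => A n `\` K n)).
  - exact: ltW.
  - by move=> n; exact: measurableD.
  - exact: measurableD.
  - move=> x [[n _ Anx] nKx]; exists n => //; split => // Kx.
    by apply: nKx; exists n.
  - by move=> n; have [] := KP n.
rewrite [e]splitr EFinD; apply: le_trans (leeD AK KN).
apply: (@le_trans _ _ (mu (((\bigcup_n A n) `\` \bigcup_n K n) `|`
   ((\bigcup_n K n) `\` \bigcup_(n < N) K n)))).
  apply: le_mu; [exact: measurableD|by apply: measurableU; exact: measurableD|].
  move=> x [Ax nKx].
  by have [Kx|Kx] := pselect ((\bigcup_n K n) x); [right|left].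
by apply: measureU2; exact: measurableD.
Qed.

Lemma compact_approx_bigcap (A : (set M)^nat) :
  (forall n, measurable (A n : set (borel M))) ->
  (forall n, compact_approx (A n)) -> compact_approx (\bigcap_n A n).
Proof.
move=> mA aA e e0.
have /choice[K KP] := fun n => aA n _ (pow2_gt0 n e0).
have mK n : measurable (K n : set (borel M)).
  by have [/compact_borel] := KP n.
have cK : compact (\bigcap_n K n).
  apply: (@subclosed_compact _ _ (K 0%N)).
  - apply: closed_bigI => n _.
    apply: compact_closed; first exact: metric_hausdorff.
    by have [] := KP n.
  - by have [] := KP 0%N.
  - by move=> x /(_ 0%N I).
exists (\bigcap_n K n); split => //.
  by move=> x Kx n _; have [_ + _] := KP n; apply; exact: Kx.
apply: (@measure_le_geometric _ _ _ mu (fun n => A n `\` K n)).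
- exact: ltW.
- by move=> n; exact: measurableD.
- by apply: measurableD; [exact: bigcap_measurable|exact: compact_borel].
- move=> x [Ax nKx]; apply: contrapT => nx; apply: nKx => n _.
  by apply: contrapT => nK; apply: nx; exists n => //; split => //; exact: Ax.
- by move=> n; have [] := KP n.
Qed.

(** Approximability is stable under countable unions and intersections, but its
    stability under complements is not evident, hence the symmetrized class G.
    Open sets are in G as countable unions of closed sets. *)
Lemma borel_compact_approx (A : set (borel M)) :
  measurable A -> compact_approx A.
Proof.
pose G := [set A : set M | [/\ measurable (A : set (borel M)),
  compact_approx A & compact_approx (~` A)]].
suff : (@measurable _ (borel M)) `<=` G by move=> /(_ A) + mA => -[].
apply: smallest_sub.
  split.
  - split; first exact: measurable0.
      by apply: compact_approx_closed; exact: closed0.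
    by apply: compact_approx_closed; rewrite setC0; exact: closedT.
  - move=> B [mB aB aCB]; rewrite setTD; split => //; first exact: measurableC.
    by rewrite setCK.
  - move=> B GB; split.
    + by apply: bigcup_measurable => n _; have [] := GB n.
    + by apply: compact_approx_bigcup => n; have [] := GB n.
    + rewrite setC_bigcup; apply: compact_approx_bigcap => n;
        have [mB aB aCB] := GB n => //.
      exact: measurableC.
move=> U oU; split.
- exact: sub_sigma_algebra.
- have [F cF ->] := open_is_Fsigma oU.
  apply: compact_approx_bigcup => n; first exact: closed_borel.
  exact: compact_approx_closed.
- by apply: compact_approx_closed; exact: open_closedC.
Qed.

End finite_measure.

(** Stated with a real a < m D so as to cover sets of infinite mass: D meets
    some F n of finite mass in a set of mass more than a, and the previous
    result applies to the finite measure that is m restricted to F n. *)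
Lemma sigma_finite_inner_regular (m : {measure set (borel M) -> \bar R})
    (D : set (borel M)) (a : R) :
  sigma_finite setT m -> measurable D -> (a%:E < m D)%E ->
  exists K : set M, [/\ compact K, K `<=` D & (a%:E < m K)%E].
Proof.
move=> /sigma_finiteP[F [FT ndF mF]] mD aD.
have mDF n : measurable (D `&` F n).
  by apply: measurableI => //; exact: (mF n).1.
have DE : \bigcup_n (D `&` F n) = D by rewrite -setI_bigcupr -FT setIT.
have ndDF : {homo (fun n => D `&` F n) : i j / (i <= j)%N >-> (i <= j)%O}.
  move=> i j ij; apply/subsetPset; apply: setIS; apply/subsetPset.
  exact: ndF.
have [n aDn] : exists n, (a%:E < m (D `&` F n))%E.
  have cv : m \o (fun n => D `&` F n) @ \oo --> m D.
    rewrite -[in X in _ --> X]DE.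
    by apply: nondecreasing_cvg_mu => //; rewrite DE.
  have eqD : m D = ereal_sup (range (m \o (fun n => D `&` F n))).
    apply: (cvg_unique _ cv); first exact: ereal_hausdorff.
    apply: ereal_nondecreasing_cvgn => i j ij.
    by apply: le_measure; rewrite ?inE//; apply/subsetPset; exact: ndDF.
  move: aD; rewrite eqD => /ereal_sup_gt[_ [n _ <-] an]; by exists n.
pose mu := mrestr m (mF n).1.
have mufin : (mu setT < +oo)%E by rewrite /mu /mrestr setTI; exact: (mF n).2.
have DFfin : m (D `&` F n) \is a fin_num.
  rewrite ge0_fin_numE//; apply: le_lt_trans (mF n).2.
  by apply: le_measure; rewrite ?inE//; exact: (mF n).1.
have e0 : 0 < (fine (m (D `&` F n)) - a) / 2.
  by rewrite divr_gt0// subr_gt0 -lte_fin fineK.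
have [K [cK KD Ke]] := @borel_compact_approx mu mufin D mD _ e0.
exists K; split => //.
have mK := compact_borel cK.
have mKF : measurable (K `&` F n : set (borel M)).
  by apply: measurableI => //; exact: (mF n).1.
have : (m (D `&` F n) <= m K + ((fine (m (D `&` F n)) - a) / 2)%:E)%E.
  apply: le_trans (leeD _ Ke); last first.
    by apply: (@le_measure _ _ _ m (K `&` F n)); rewrite ?inE//.
  rewrite /mu /mrestr.
  apply: le_trans (measureU2 _ _ _) => //; last first.
    by apply: measurableI; [exact: measurableD|exact: (mF n).1].
  apply: le_measure; rewrite ?inE//.
    apply: measurableU => //.
    by apply: measurableI; [exact: measurableD|exact: (mF n).1].
  move=> x [Dx Fx]; have [Kx|Kx] := pselect (K x); [by left|by right].
move: e0; have /fineK <- := DFfin.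
have : (0 <= m K)%E by [].
case: (m K) => [k| |] //= _; last by rewrite ltry.
by rewrite -EFinD lee_fin lte_fin; lra.
Qed.

End inner_regularity.

(** * Approximate intermediate points *)

Section approximate_interpolation.
Context (R : realType) (X : pointedMetricType R).
Implicit Types (k s d : R) (x y : X).

Lemma mdist_perturb x x' y y' :
  `|mdist x y - mdist x' y'| <= mdist x x' + mdist y y'.
Proof.
have h1 := metric_triangle x x' y; have h2 := metric_triangle x' y' y.
have h3 := metric_triangle x' x y'; have h4 := metric_triangle x y y'.
rewrite (metric_sym x' x) in h3; rewrite (metric_sym y' y) in h2.
by rewrite ler_norml; apply/andP; split; lra.
Qed.

Definition interp_point k s x0 x1 x : Prop :=
  `|mdist x0 x - s * mdist x0 x1| <= k /\
  `|mdist x x1 - (1 - s) * mdist x0 x1| <= k.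

(** The first distance varies by at most 2d, and the second term by 2d times s
    or 1 - s, which is where 4d comes from. *)
Lemma interp_point_perturb k s d x0 x1 x y0 y1 y : 0 <= s <= 1 ->
  mdist x0 y0 <= d -> mdist x1 y1 <= d -> mdist x y <= d ->
  interp_point k s x0 x1 x -> interp_point (k + 4 * d) s y0 y1 y.
Proof.
move=> /andP[s0 s1] d0 d1 dx [k0 k1].
have d_ge0 : 0 <= d by apply: le_trans dx; exact: mdist_ge0.
have e0 : `|mdist x0 x - mdist y0 y| <= 2 * d.
  by apply: le_trans (mdist_perturb _ _ _ _) _; lra.
have e1 : `|mdist x x1 - mdist y y1| <= 2 * d.
  by apply: le_trans (mdist_perturb _ _ _ _) _; lra.
have e01 : `|mdist x0 x1 - mdist y0 y1| <= 2 * d.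
  by apply: le_trans (mdist_perturb _ _ _ _) _; lra.
have scaled (t : R) : 0 <= t <= 1 ->
    `|t * (mdist x0 x1 - mdist y0 y1)| <= 2 * d.
  move=> /andP[t0 t1]; rewrite normrM ger0_norm//.
  by apply: le_trans e01; rewrite ler_piMl.
have {}s01 : 0 <= s <= 1 by rewrite s0.
have ss01 : 0 <= 1 - s <= 1 by apply/andP; split; lra.
move: k0 k1 e0 e1 (scaled _ s01) (scaled _ ss01); rewrite !ler_norml.
move=> /andP[? ?] /andP[? ?] /andP[? ?] /andP[? ?] /andP[? ?] /andP[? ?].
by split; rewrite ler_norml; apply/andP; split; lra.
Qed.

(** Combined with the perturbation bound, this margin shows that not being an
    intermediate point is an open condition on the three points together. *)
Lemma not_interp_point_slack k s x0 x1 x : ~ interp_point k s x0 x1 x ->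
  exists2 d, 0 < d & ~ interp_point (k + 4 * d) s x0 x1 x.
Proof.
rewrite /interp_point; set u := `|_|; set v := `|_|.
move=> /not_andP[/negP|/negP]; rewrite -ltNge => ku.
- by exists ((u - k) / 8); [lra|move=> [+ _]; lra].
- by exists ((v - k) / 8); [lra|move=> [_ +]; lra].
Qed.

(** The projection of a closed set along the compact set C0 x C1 is closed: near
    each pair, failing to be an intermediate point persists for nearby points
    and pairs, and compactness makes the neighbourhood of x uniform. *)
Lemma closed_interp k s (C0 C1 : set X) : 0 <= s <= 1 ->
  compact C0 -> compact C1 -> closed (interp k s C0 C1).
Proof.
move=> s01 cC0 cC1 x clx; apply: contrapT => nx.
have /compact_near_coveringP cov := compact_setX cC0 cC1.
have near_x : \forall y \near x, C0 `*` C1 `<=`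
    [set q | ~ interp_point k s q.1 q.2 y].
  apply: cov => -[a b] [/= Ca Cb].
  have [d d0 nd] : exists2 d, 0 < d & ~ interp_point (k + 4 * d) s a b x.
    by apply: not_interp_point_slack => -[? ?]; apply: nx; exists a, b.
  exists ((ball a d `*` ball b d), ball x d).
    split; last exact: nbhsx_ballx.
    by exists (ball a d, ball b d) => //; split; exact: nbhsx_ballx.
  move=> [[a' b'] y] [[/= aa' bb'] xy]; apply: contra_not nd.
  apply: interp_point_perturb => //; rewrite metric_sym ltW//.
  - by move: aa'; rewrite ballEmdist.
  - by move: bb'; rewrite ballEmdist.
  - by move: xy; rewrite ballEmdist.
have [y [[a [b [Ca Cb h1 h2]]] /(_ (a, b) (conj Ca Cb))]] := clx _ near_x.
by apply.
Qed.

End approximate_interpolation.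

(** * Passing to suprema in the extended reals *)

Section extended_real_suprema.
Context (R : realType).
Local Open Scope ereal_scope.

(** Also valid for c = 0 and x = +oo, as 0 * +oo = 0: any a then gives 0 <= t. *)
Lemma lee_mul_of_lt (c : R) (x t : \bar R) : (0 <= c)%R -> 0 <= x ->
  (forall a : R, a%:E < x -> (c * a)%:E <= t) -> c%:E * x <= t.
Proof.
move=> c0 x0 H; have xN1 : (-1)%:E < x.
  by apply: (lt_le_trans _ x0); rewrite lte_fin; lra.
have := H _ xN1; case: t H => [t| |] H //; last by move=> _; exact: leey.
rewrite lee_fin => Ht; move: c0; rewrite le_eqVlt => /predU1P[c0|c0].
  by move: Ht; rewrite -c0 mul0e mul0r lee_fin.
rewrite leNgt; apply/negP.
case: x x0 {xN1} H => [x _|_|//] H.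
- rewrite -EFinM lte_fin => tx.
  have /H : ((t / c + x) / 2)%:E < x%:E.
    have tcx : (t / c < x)%R by rewrite ltr_pdivrMr// mulrC.
    by rewrite lte_fin; lra.
  have -> : (c * ((t / c + x) / 2) = (t + c * x) / 2)%R by field; lra.
  by rewrite lee_fin; lra.
- move=> _; have /H := ltry (t / c + 1)%R.
  have -> : (c * (t / c + 1) = t + c)%R by field; lra.
  by rewrite lee_fin; lra.
Qed.

(** When t is finite, bounding the two terms one after the other works because
    the bound on the first one makes it finite, so that it can be moved to the
    right-hand side. *)
Lemma lee_convex_of_lt (s : R) (x y t : \bar R) : (0 <= s <= 1)%R ->
  0 <= x -> 0 <= y ->
  (forall a b : R, a%:E < x -> b%:E < y -> ((1 - s) * a + s * b)%:E <= t) ->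
  (1 - s)%:E * x + s%:E * y <= t.
Proof.
move=> /andP[s0 s1] x0 y0 H.
have lt_N1 (z : \bar R) : 0 <= z -> (-1)%:E < z.
  by apply: lt_le_trans; rewrite lte_fin; lra.
have := H _ _ (lt_N1 _ x0) (lt_N1 _ y0).
case: t H => [t| |] H // _; last exact: leey.
have Hx (b : R) : b%:E < y -> (1 - s)%:E * x <= (t - s * b)%:E.
  move=> by_; apply: lee_mul_of_lt => //; first by lra.
  by move=> a ax; have := H _ _ ax by_; rewrite !lee_fin; lra.
have xfin : (1 - s)%:E * x \is a fin_num.
  rewrite ge0_fin_numE ?mule_ge0// ?lee_fin; last by lra.
  by apply: le_lt_trans (Hx _ (lt_N1 _ y0)) _; rewrite ltry.
rewrite -leeBrDl//; move: xfin Hx => /fineK <-; set z := fine _ => Hx.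
apply: lee_mul_of_lt => // b /Hx.
by rewrite -EFinB !lee_fin; lra.
Qed.

End extended_real_suprema.

(** Inner regularity in the form needed by BM(N), whose compact sets are
    nonempty: the singleton of x0 serves for a < 0, and x0 is added to K
    otherwise. *)
Lemma inner_regular_poweR (R : realType) (M : completeMetricType R)
    (m : {measure set (borel M) -> \bar R}) (N : nat) (D : set (borel M))
    (x0 : M) (a : R) :
  separable_space M -> sigma_finite setT m -> (1 <= N)%N ->
  measurable D -> D x0 -> (a%:E < poweR (m D) N%:R^-1)%E ->
  exists K : set M, [/\ compact K, K `<=` D, K !=set0 &
    (a%:E <= poweR (m K) N%:R^-1)%E].
Proof.
move=> sepM sfm N1 mD Dx0 aD; have [a0|a0] := ltP a 0.
  exists [set x0]; split; [exact: compact_set1|by move=> _ ->|by exists x0|].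
  by apply: le_trans (poweR_ge0 _ _); rewrite lee_fin ltW.
have N0 : N%:R != 0 :> R by rewrite pnatr_eq0 -lt0n.
have aE : a%:E = poweR (a `^ N%:R)%:E N%:R^-1.
  by rewrite poweR_EFin -powRrM mulfV// powRr1.
have itv (z : \bar R) : (0 <= z)%E -> z \in `[0%E, +oo%E].
  by move=> z0; rewrite in_itv/= z0 leey.
have mono (y z : \bar R) : (0 <= y)%E -> (0 <= z)%E -> (y <= z)%E ->
    (poweR y N%:R^-1 <= poweR z N%:R^-1)%E.
  by move=> y0 z0; apply: gt0_ler_poweR; rewrite ?itv// invr_ge0.
have aND : ((a `^ N%:R)%:E < m D)%E.
  rewrite ltNge; apply/negP => mDa; move: aD.
  by rewrite ltNge aE mono// lee_fin powR_ge0.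
have [K [cK KD aK]] := sigma_finite_inner_regular sepM sfm mD aND.
exists (x0 |` K); split.
- by apply: compactU => //; exact: compact_set1.
- by move=> y [->|/KD].
- by exists x0; left.
- rewrite aE; apply: mono => //; first by rewrite lee_fin powR_ge0.
  apply: le_trans (ltW aK) _; apply: le_measure; rewrite ?inE.
  + exact: compact_borel.
  + by apply: compact_borel; apply: compactU => //; exact: compact_set1.
  + by move=> x; right.
Qed.

(** * Mass of unions of cells *)

Section discretization_mass.
Context (R : realType) (M : pointedMetricType R).
Variable m : {measure set (borel M) -> \bar R}.
Context (Mh : set M) (Mh0 : Mh !=set0).
Variable mh : {measure set (borel (metric_sub Mh0)) -> \bar R}.
Variable A : M -> set M.
Hypotheses (cMh : countable Mh)
  (mA : forall x, Mh x -> measurable (A x : set (borel M)))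
  (tA : trivIset Mh A)
  (mhA : forall x : metric_sub Mh0, mh [set x] = m (A (metric_sub_val x))).

Definition cells (C : set (metric_sub Mh0)) : set M :=
  \bigcup_(x in C) A (metric_sub_val x).

Let cell_index_in (x : metric_sub Mh0) : Mh (metric_sub_val x).
Proof. exact: set_valP. Qed.

Let indexing : {f : metric_sub Mh0 -> nat | injective f}.
Proof.
apply: cid; have /countable_injP[f fi] := cMh.
exists (f \o @metric_sub_val _ _ _ Mh0) => x y /= fxy.
by apply: val_inj; apply: fi fxy; rewrite inE; exact: cell_index_in.
Qed.

(* Countable additivity is stated for sequences: C is cut into a sequence of
   sets with at most one point by an injection of [Mh] into the integers. *)
Let layer (C : set (metric_sub Mh0)) (n : nat) :=
  C `&` [set x | projT1 indexing x = n].

Let layer_split C n : layer C n = set0 \/ exists2 x, C x & layer C n = [set x].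
Proof.
have [->|/set0P[x [Cx xn]]] := eqVneq (layer C n) set0; [by left|right].
exists x => //; apply/seteqP; split => [y [_ yn]|_ ->//].
by apply: (projT2 indexing); rewrite xn.
Qed.

Let bigcup_layer C : \bigcup_n layer C n = C.
Proof.
apply/seteqP; split => [x [n _ []//]|x Cx].
by exists (projT1 indexing x).
Qed.

Let cells_bigcup C : cells C = \bigcup_n cells (layer C n).
Proof.
apply/seteqP; split => [z [x Cx Axz]|z [n _ [x [Cx _] Axz]]]; last by exists x.
by exists (projT1 indexing x) => //; exists x.
Qed.

Let measurable_cells_layer C n : measurable (cells (layer C n) : set (borel M)).
Proof.
rewrite /cells; have [->|[x _ ->]] := layer_split C n.
  by rewrite bigcup_set0; exact: measurable0.
by rewrite bigcup_set1; apply: mA; exact: cell_index_in.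
Qed.

Lemma measurable_cells C : measurable (cells C : set (borel M)).
Proof. by rewrite cells_bigcup; exact: bigcup_measurable. Qed.

Lemma discrete_measurable (C : set (borel (metric_sub Mh0))) : measurable C.
Proof.
rewrite -(bigcup_layer C); apply: bigcup_measurable => n _.
have [->|[x _ ->]] := layer_split C n; first exact: measurable0.
by apply: compact_borel; exact: compact_set1.
Qed.

Lemma discretization_mass (C : set (metric_sub Mh0)) : mh C = m (cells C).
Proof.
rewrite cells_bigcup -[in LHS](bigcup_layer C).
have tlayer : trivIset setT (layer C).
  by move=> i j _ _ [x [[_ <-] [_ <-]]].
have tcells : trivIset setT (fun n => cells (layer C n)).
  move=> i j _ _ [z [[x [_ xi] Axz] [y [_ yj] Ayz]]].
  have xy : x = y.
    apply: val_inj; apply: (tA (cell_index_in x) (cell_index_in y)).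
    by exists z.
  by rewrite -xi -yj xy.
rewrite (measure_bigcup mh)//; last by move=> n _; exact: discrete_measurable.
rewrite (measure_bigcup m)//; apply: eq_eseriesr => n _; rewrite /cells.
have [->|[x _ ->]] := layer_split C n; first by rewrite bigcup_set0 !measure0.
by rewrite bigcup_set1 mhA.
Qed.

End discretization_mass.

(** * The Brunn-Minkowski inequality on the discretization *)

Theorem theorem3p1 (R : realType) (N : nat) (M : completeMetricType R)
    (m : {measure set (borel M) -> \bar R}) (h : R)
    (Mh : set M) (Mh0 : Mh !=set0)
    (mh : {measure set (borel (metric_sub Mh0)) -> \bar R}) :
  (1 <= N)%N ->
  polish_mmspace m ->
  0 < h ->
  discretization m h mh ->
  BM m N 0 ->
  BM mh N (4 * h).
Proof.
move=> N1 [sepM sfm _] h0 [cMh _ [A [mA Ah AA tA [AT mhA]]]] bm.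
move=> C0 C1 _ _ [c0 C0c0] [c1 C1c1] s s01.
have mass := discretization_mass cMh mA tA mhA.
have mcells C := measurable_cells cMh mA (C : set (metric_sub Mh0)).
rewrite !mass.
apply: lee_convex_of_lt => //; [exact: poweR_ge0|exact: poweR_ge0|].
move=> a b aC bC.
have AAv (x : metric_sub Mh0) : A (metric_sub_val x) (metric_sub_val x).
  by apply: AA; exact: set_valP.
have Ahv (x : metric_sub Mh0) z :
    A (metric_sub_val x) z -> mdist z (metric_sub_val x) <= h.
  by move=> /(Ah _ (set_valP _)); rewrite ballEmdist metric_sym => /ltW.
have [K0 [cK0 K0C K00 aK0]] :=
  @inner_regular_poweR _ _ _ _ _ (metric_sub_val c0) _ sepM sfm N1 (mcells C0)
    (ex_intro2 _ _ c0 C0c0 (AAv c0)) aC.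
have [K1 [cK1 K1C K10 bK1]] :=
  @inner_regular_poweR _ _ _ _ _ (metric_sub_val c1) _ sepM sfm N1 (mcells C1)
    (ex_intro2 _ _ c1 C1c1 (AAv c1)) bC.
have /andP[s0 s1] := s01.
apply: (@le_trans _ _ ((1 - s)%:E * poweR (m K0) N%:R^-1 +
                       s%:E * poweR (m K1) N%:R^-1)%E).
  rewrite EFinD !EFinM.
  by apply: leeD; apply: lee_wpmul2l; rewrite // lee_fin; lra.
apply: le_trans (bm _ _ cK0 cK1 K00 K10 _ s01) _.
apply: gt0_ler_poweR; rewrite ?invr_ge0// ?in_itv/= ?measure_ge0 ?leey//.
apply: le_measure; rewrite ?inE.
- by apply: closed_borel; exact: closed_interp.
- exact: mcells.
move=> z [k0 [k1 [K0k0 K1k1 zk0 zk1]]].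
have [x Mhx Axz] : (\bigcup_(x in Mh) A x) z by rewrite AT.
have [x0 C0x0 Ax0] := K0C _ K0k0; have [x1 C1x1 Ax1] := K1C _ K1k1.
pose xh : metric_sub Mh0 := SigSub (mem_set Mhx).
exists xh => //; exists x0, x1.
(* Exact intermediate points have k = 0, and cells have radius d = h. *)
have := @interp_point_perturb _ _ 0 s h k0 k1 z (metric_sub_val x0)
  (metric_sub_val x1) x s01 (Ahv _ _ Ax0) (Ahv _ _ Ax1) (Ahv xh _ Axz)
  (conj zk0 zk1).
by rewrite add0r => -[? ?].
Qed.
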